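(* Let $F_m$ denote the $m$-th Fibonacci polynomial and $F_m''$ its second derivative. For any odd number $s\in 1+2\mathbb{Z}_2$: 1. $F_{3\cdot 2^{l}}''(s)\equiv 0 \pmod{2^{l+1}}$ and $F_{3\cdot 2^{l}+1}''(s)\equiv 2^{l} \pmod{2^{l+1}}$ for any positive integer $l$; 2. the sequence $\{F_m''(s) \bmod 2^{l+1}\}_{m\ge 0}$ is periodic of period $3\cdot 2^{l+1}$ for any positive integer $l$.
   Context: $\mathbb{Z}_2$ is the ring of 2-adic integers. The Fibonacci polynomials are defined by $F_0(x)=0$, $F_1(x)=1$, $F_m(x)=xF_{m-1}(x)+F_{m-2}(x)$ for $m\ge 2$. A sequence $\{f_m\}_{m\ge 0}$ is called periodic of period $d$ if $d$ is the least positive integer such that $f_{m+d}=f_m$ for every $m$. *)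

(* Defs.v *)
From HB Require Import structures.
From mathcomp Require Import all_boot all_order all_algebra.
From mathcomp Require Import boolp.

Set Implicit Arguments.
Unset Strict Implicit.
Unset Printing Implicit Defensive.

Import GRing.Theory.
Local Open Scope ring_scope.

(* The 2-adic integers as the inverse limit of the rings Z/2^k, k >= 1.  The
   component of index n lives in Z/2^(n+1): level 0 of the usual tower is the
   zero ring, and 'Z_1 would denote Z/2 instead. *)
Record Z2 := MkZ2 {
  residue : forall n : nat, 'Z_(2 ^ n.+1);
  residue_coherent : forall n, (residue n.+1 : nat)%:R = residue n }.

Lemma Z2P (x y : Z2) : (forall n, residue x n = residue y n) -> x = y.
Proof.
case: x y => [x hx] [y hy] /= exy.
have {}exy : x = y by apply: functional_extensionality_dep.
by case: y / exy hy => hy; rewrite (Prop_irrelevance hx hy).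
Qed.

Lemma pow2_gt1 n : (1 < 2 ^ n.+1)%N.
Proof. by rewrite -{1}(expn0 2) ltn_exp2l. Qed.

Lemma pow2_dvdS n : (2 ^ n.+1 %| 2 ^ n.+2)%N.
Proof. exact: dvdn_exp2l. Qed.

Lemma natr_modZ n m : ((m %% (Zp_trunc (2 ^ n.+2)).+2)%:R : 'Z_(2 ^ n.+1)) = m%:R.
Proof.
rewrite [X in (m %% X)%N](Zp_cast (pow2_gt1 n.+1)) -[LHS]Zp_nat_mod ?pow2_gt1 //.
by rewrite modn_dvdm ?pow2_dvdS // Zp_nat_mod ?pow2_gt1.
Qed.

Lemma Z2_zero_coherent n : (nat_of_ord (0%R : 'Z_(2 ^ n.+2)))%:R = 0 :> 'Z_(2 ^ n.+1).
Proof. by []. Qed.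

Lemma Z2_one_coherent n : (nat_of_ord (1%R : 'Z_(2 ^ n.+2)))%:R = 1 :> 'Z_(2 ^ n.+1).
Proof. by rewrite /= natr_modZ. Qed.

Lemma Z2_add_coherent (x y : Z2) n :
  (nat_of_ord (residue x n.+1 + residue y n.+1)%R)%:R = residue x n + residue y n.
Proof. by rewrite /= natr_modZ natrD !residue_coherent. Qed.

Lemma Z2_opp_coherent (x : Z2) n :
  (nat_of_ord (- residue x n.+1)%R)%:R = - residue x n.
Proof.
apply/eqP; rewrite -addr_eq0 -[X in _ + X]residue_coherent -natrD.
by rewrite -natr_modZ -[X in X%:R]/(nat_of_ord (- residue x n.+1 + _)%R) addNr.
Qed.

Lemma Z2_mul_coherent (x y : Z2) n :
  (nat_of_ord (residue x n.+1 * residue y n.+1)%R)%:R = residue x n * residue y n.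
Proof. by rewrite /= natr_modZ natrM !residue_coherent. Qed.

Definition Z2_zero := MkZ2 Z2_zero_coherent.
Definition Z2_one := MkZ2 Z2_one_coherent.
Definition Z2_add x y := MkZ2 (Z2_add_coherent x y).
Definition Z2_opp x := MkZ2 (Z2_opp_coherent x).
Definition Z2_mul x y := MkZ2 (Z2_mul_coherent x y).

Lemma Z2_addA : associative Z2_add.
Proof. by move=> x y z; apply: Z2P => n /=; rewrite addrA. Qed.
Lemma Z2_addC : commutative Z2_add.
Proof. by move=> x y; apply: Z2P => n /=; rewrite addrC. Qed.
Lemma Z2_add0 : left_id Z2_zero Z2_add.
Proof. by move=> x; apply: Z2P => n /=; rewrite add0r. Qed.
Lemma Z2_addN : left_inverse Z2_zero Z2_opp Z2_add.
Proof. by move=> x; apply: Z2P => n /=; rewrite addNr. Qed.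
Lemma Z2_mulA : associative Z2_mul.
Proof. by move=> x y z; apply: Z2P => n /=; rewrite mulrA. Qed.
Lemma Z2_mulC : commutative Z2_mul.
Proof. by move=> x y; apply: Z2P => n /=; rewrite mulrC. Qed.
Lemma Z2_mul1 : left_id Z2_one Z2_mul.
Proof. by move=> x; apply: Z2P => n /=; rewrite mul1r. Qed.
Lemma Z2_mulD : left_distributive Z2_mul Z2_add.
Proof. by move=> x y z; apply: Z2P => n /=; rewrite mulrDl. Qed.

HB.instance Definition _ := gen_eqMixin Z2.
HB.instance Definition _ := gen_choiceMixin Z2.
HB.instance Definition _ :=
  GRing.isZmodule.Build Z2 Z2_addA Z2_addC Z2_add0 Z2_addN.

Lemma Z2_one_neq0 : Z2_one != 0.
Proof. by apply/eqP => /(congr1 (fun x : Z2 => residue x 0)). Qed.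

HB.instance Definition _ :=
  GRing.Zmodule_isComNzRing.Build Z2 Z2_mulA Z2_mulC Z2_mul1 Z2_mulD Z2_one_neq0.

(* x = y mod 2^k in Z2, i.e. x - y lies in the ideal 2^k Z2. *)
Definition cong2 (k : nat) (x y : Z2) : Prop := exists t : Z2, x - y = 2 ^+ k * t.

Definition residueZ n (x : Z2) : 'Z_(2 ^ n.+1) := residue x n.

Lemma residueZ_zmod n : zmod_morphism (residueZ n).
Proof. by []. Qed.
Lemma residueZ_monoid n : monoid_morphism (residueZ n).
Proof. by []. Qed.
HB.instance Definition _ n :=
  GRing.isZmodMorphism.Build _ _ (residueZ n) (@residueZ_zmod n).
HB.instance Definition _ n :=
  GRing.isMonoidMorphism.Build _ _ (residueZ n) (@residueZ_monoid n).

Lemma residue_mod (x : Z2) n j : (residue x (j + n) %% 2 ^ n.+1)%N = residue x n.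
Proof.
have lt k : (residue x k < 2 ^ k.+1)%N.
  by rewrite -{2}(Zp_cast (pow2_gt1 k)).
elim: j => [|j IHj]; first by rewrite modn_small.
rewrite -IHj -(residue_coherent x (j + n)) val_Zp_nat ?pow2_gt1 //.
by rewrite modn_dvdm // dvdn_exp2l // ltnS leq_addl.
Qed.

(* The fibres of x |-> residueZ n x are exactly the classes mod 2^(n+1), so this
   map is reduction modulo 2^(n+1). *)
Lemma residueZ_eqP n (x y : Z2) : residueZ n x = residueZ n y <-> cong2 n.+1 x y.
Proof.
split=> [exy|[t /(congr1 (residueZ n))]]; last first.
  rewrite rmorphB rmorphM rmorphXn rmorph_nat -natrX pchar_Zp ?pow2_gt1 // mul0r.
  by move/eqP; rewrite subr_eq0 => /eqP.
pose z := x - y.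
have z0 : residue z n = 0 by rewrite -[LHS]/(residueZ n z) rmorphB /= exy subrr.
have [r rE] : {r : nat -> nat | forall k, r k = residue z k}.
  by exists (fun k => residue z k).
have rm m j : (r (j + m) %% 2 ^ m.+1)%N = r m by rewrite !rE residue_mod.
have dz j : (2 ^ n.+1 %| r (j + n.+1))%N.
  by rewrite addnS -addSn /dvdn rm rE z0.
pose q j := (r (j + n.+1) %/ 2 ^ n.+1)%N.
pose t j : 'Z_(2 ^ j.+1) := (q j)%:R.
have tc j : (t j.+1 : nat)%:R = t j.
  rewrite /t val_Zp_nat ?pow2_gt1 //.
  have -> : q j = (q j.+1 %% 2 ^ j.+1)%N.
    apply/eqP; rewrite -(eqn_pmul2r (expn_gt0 2 n.+1)) muln_modl -expnD.
    by rewrite !divnK //; apply/eqP/esym; exact: (rm (j + n.+1)%N 1%N).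
  by rewrite -[LHS]Zp_nat_mod ?pow2_gt1 // modn_dvdm ?pow2_dvdS.
exists (MkZ2 tc); apply: Z2P => j.
rewrite -[LHS]/(residue z j) -[RHS]/(residueZ j (2 ^+ n.+1 * MkZ2 tc)).
rewrite rmorphM rmorphXn rmorph_nat -[X in _ * X]/(t j) /t -natrX -natrM.
rewrite mulnC divnK //; apply: val_inj.
rewrite -[RHS]/(nat_of_ord (r (j + n.+1)%N)%:R) val_Zp_nat ?pow2_gt1 // addnC rm rE //.
Qed.

Fixpoint fibpoly (R : nzRingType) (m : nat) : {poly R} :=
  match m with
  | 0 => 0
  | m1.+1 => match m1 with
             | 0 => 1
             | m2.+1 => 'X * fibpoly R m1 + fibpoly R m2
             end
  end.

Definition has_period (T : Type) (f : nat -> T) (d : nat) : Prop :=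
  (0 < d)%N /\ (forall m, f (m + d)%N = f m).

(* "Periodic of period d": d is the least positive shift fixing f. *)
Definition periodic_of_period (T : Type) (f : nat -> T) (d : nat) : Prop :=
  has_period f d /\ (forall d', has_period f d' -> (d <= d')%N).

(* Main.v *)
Require Import Defs.
From HB Require Import structures.
From mathcomp Require Import all_boot all_order all_algebra.
From mathcomp Require Import ring.
Set Implicit Arguments.
Unset Strict Implicit.
Unset Printing Implicit Defensive.
Import GRing.Theory.
Local Open Scope ring_scope.

(** The matrix with entries F_(n+1), F_n, F_n, F_(n-1) is the n-th power of the
    Fibonacci matrix.  Take its expansion to second order at an odd s: for
    n = 3 * 2^l it approaches the identity 2-adically, and squaring the matrix
    doubles n while gaining one factor 2 in every coefficient.  What has to be
    found are the exponents of 2 at which this induction closes up: with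
    q = 2^l, the values of F_n, F_n', F_n'' are divisible by 4q, 2q, 2q, while
    F_(n+1), F_(n+1)', F_(n+1)'' are 1 mod 2q, 0 mod q and q mod 2q
    ([fib_jet_pow2]).  The step ([fib_jet_double]) is the product rule applied
    to the duplication formulas; it needs q even because of the square of
    F_(n+1)'.  The start is n = 6.  The last congruence is the first part of
    the theorem.

    For the second part, the same congruences at n = 3 * 2^(l+1), put in the
    addition formula, make n a period modulo 2^(l+1).  Periods of a sequence
    are closed under gcd, so n is the least one as soon as neither n/2 nor n/3
    is a period ([period_minimal]).  The first part shows that n/2 = 3 * 2^l
    changes the value at m = 1.  If n/3 = 2^(l+1) were a period, then so would
    be gcd(12, 2^(l+1)) = 4 modulo 4, but F_4''(s) = 6s is not 0 modulo 4. *)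

(** * Periods of a sequence *)

Section Periods.
Variables (T : Type) (f : nat -> T).

Lemma has_period_mul d k m : has_period f d -> f (m + k * d)%N = f m.
Proof.
case=> _ fd; elim: k => [|k IHk]; first by rewrite mul0n addn0.
by rewrite mulSn addnCA addnC fd.
Qed.

Lemma has_period_dvd d e :
  (0 < e)%N -> (d %| e)%N -> has_period f d -> has_period f e.
Proof.
by move=> e_gt0 /dvdnP[k ek] fd; split=> // m; rewrite ek has_period_mul.
Qed.

Lemma has_period_gcd d e :
  has_period f d -> has_period f e -> has_period f (gcdn d e).
Proof.
move=> fd fe; have d_gt0 : (0 < d)%N by case: fd.
split=> [|m]; first by rewrite gcdn_gt0 d_gt0.
case: (egcdnP e d_gt0) => kd ke bezout _.
rewrite -(has_period_mul ke _ fe) -addnA [(gcdn d e + _)%N]addnC -bezout.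
exact: has_period_mul.
Qed.

(** A smaller period would yield, by gcd, a proper divisor of n as a period,
    hence also n / p for some prime p. *)
Lemma period_minimal n :
  has_period f n ->
  (forall p, prime p -> (p %| n)%N -> ~ has_period f (n %/ p)%N) ->
  periodic_of_period f n.
Proof.
move=> fn no_div; split=> // d fd; have fg := has_period_gcd fd fn.
have d_gt0 : (0 < d)%N by case: fd.
have n_gt0 : (0 < n)%N by case: fn.
have g_gt0 : (0 < gcdn d n)%N by case: fg.
have nE := divnK (dvdn_gcdr d n).
case: (ltngtP (n %/ gcdn d n) 1) => [|k_gt1|k1].
- by rewrite ltnNge divn_gt0 // dvdn_leq // dvdn_gcdr.
- have p_pr := pdiv_prime k_gt1; set p := pdiv _ in p_pr.
  have p_dvd : (p %| n %/ gcdn d n)%N by apply: pdiv_dvd.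
  have pn : (p %| n)%N by rewrite -nE dvdn_mulr.
  case: (no_div p p_pr pn); apply: has_period_dvd fg.
    by rewrite divn_gt0 ?prime_gt0 // dvdn_leq.
  by rewrite dvdn_divRL // -{2}nE mulnC dvdn_mul.
- by rewrite -nE k1 mul1n dvdn_leq // dvdn_gcdl.
Qed.

End Periods.

(** * Addition and duplication formulas *)

Section FibPoly.
Variable R : comNzRingType.
Local Notation F := (fibpoly R).

Lemma fibpolySS m : F m.+2 = 'X * F m.+1 + F m.
Proof. by []. Qed.

Lemma fibpoly_addS m n : F (m + n).+1 = F m.+1 * F n.+1 + F m * F n.
Proof.
elim: m n => [|m IHm] n; first by rewrite /= mul1r mul0r addr0.
by rewrite addSnnS IHm !fibpolySS; ring.
Qed.

(** The factor F (m - 1) of the usual formula is written F m.+1 - 'X * F m, so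
    that the case m = 0 is covered. *)
Lemma fibpoly_add m n :
  F (m + n) = F m * F n.+1 + (F m.+1 - 'X * F m) * F n.
Proof.
case: m => [|m]; first by rewrite /= mulr0 subr0 mul0r add0r mul1r.
by rewrite addSn fibpoly_addS fibpolySS; ring.
Qed.

Lemma fibpoly_double n : F (n + n) = F n * (F n.+1 *+ 2 - 'X * F n).
Proof. by rewrite fibpoly_add; ring. Qed.

Lemma fibpoly_doubleS n : F (n + n).+1 = F n.+1 * F n.+1 + F n * F n.
Proof. exact: fibpoly_addS. Qed.

End FibPoly.

(** * Second-order expansions modulo powers of two *)

Section Jets.
Variable R : comNzRingType.
Local Notation F := (fibpoly R).

Definition eqmod (q x y : R) := exists t, x = y + q * t.

(** The multiples of q are chosen so that, for even q, the relation passes from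
    (q, n) to (2q, 2n). *)
Definition fib_jet_near_one (s q : R) n :=
  [/\ eqmod (4 * q) (F n).[s] 0, eqmod (2 * q) (F n)^`().[s] 0
    & eqmod (2 * q) (F n)^`()^`().[s] 0]
  /\ [/\ eqmod (2 * q) (F n.+1).[s] 1, eqmod q (F n.+1)^`().[s] 0
    & eqmod (2 * q) (F n.+1)^`()^`().[s] q].


(** Small cases are computed with this recurrence on values, so that no
    expanded polynomial has to be differentiated. *)
Lemma fib_jet_rec (s : R) m :
  [/\ (F m.+2).[s] = s * (F m.+1).[s] + (F m).[s],
      (F m.+2)^`().[s] = (F m.+1).[s] + s * (F m.+1)^`().[s] + (F m)^`().[s]
    & (F m.+2)^`()^`().[s] =
        2 * (F m.+1)^`().[s] + s * (F m.+1)^`()^`().[s] + (F m)^`()^`().[s]].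
Proof.
rewrite fibpolySS; move: (F m.+1) (F m) => B A.
rewrite !(derivD, derivM, derivX, mul1r) !(hornerD, hornerM, hornerX).
by split; ring.
Qed.

Lemma fib_jet_4 (s : R) : (F 4)^`()^`().[s] = 6 * s.
Proof.
case: (fib_jet_rec s 0) (fib_jet_rec s 1) (fib_jet_rec s 2).
rewrite ![fibpoly R 0]/= ![fibpoly R 1]/= !(deriv0, derivC, hornerC).
case=> f2 g2 h2 [f3 g3 h3] [f4 g4 h4].
by rewrite h4 g3 h3 f2 g2 h2; ring.
Qed.

Lemma fib_jet_6 (s t : R) : s = 1 + 2 * t -> fib_jet_near_one s 2 6.
Proof.
move=> s_odd.
have [f2 g2 h2] := fib_jet_rec s 0; have [f3 g3 h3] := fib_jet_rec s 1.
have [f4 g4 h4] := fib_jet_rec s 2; have [f5 g5 h5] := fib_jet_rec s 3.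
have [f6 g6 h6] := fib_jet_rec s 4; have [f7 g7 h7] := fib_jet_rec s 5.
move: f2 g2 h2 f3 g3 h3.
rewrite ![fibpoly R 0]/= ![fibpoly R 1]/= !(deriv0, derivC, hornerC).
move=> f2 g2 h2 f3 g3 h3.
pose u := t + t ^+ 2.
rewrite /fib_jet_near_one /eqmod.
rewrite !(h7, g7, f7, h6, g6, f6, h5, g5, f5, h4, g4, f4).
rewrite !(h3, g3, f3, h2, g2, f2).
(* With s ^+ 2 = 1 + 4 * u, the first and fourth witnesses come from
   F_6 = s (s^2 + 1) (s^2 + 3) and F_7 = 1 + s^2 (s^2 + 2) (s^2 + 3), the
   others from the coefficients of the derivatives. *)
split; split.
- by exists (s * (1 + 2 * u) * (1 + u)); rewrite /u s_odd; ring.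
- by exists (5 + 22 * u + 20 * u ^+ 2); rewrite /u s_odd; ring.
- by exists (5 * s ^+ 3 + 6 * s); ring.
- by exists (s ^+ 2 * (s ^+ 2 + 2) * (1 + u)); rewrite /u s_odd; ring.
- by exists (3 * s ^+ 5 + 10 * s ^+ 3 + 6 * s); ring.
- by exists (10 + 60 * u + 120 * u ^+ 2 + 15 * s ^+ 2); rewrite /u s_odd; ring.
Qed.

(** Evenness of q = 2r is used once: (F n.+1)'^2 contributes 2 q^2 b1^2 to the
    last congruence, which must vanish modulo 4q. *)
Lemma fib_jet_double (s r : R) n :
  fib_jet_near_one s (2 * r) n -> fib_jet_near_one s (2 * (2 * r)) (n + n).
Proof.
rewrite /fib_jet_near_one /eqmod fibpoly_double fibpoly_doubleS.
move: (F n) (F n.+1) => A B.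
case=> [[[a0 A0] [a1 A1] [a2 A2]] [[b0 B0] [b1 B1] [b2 B2]]].
rewrite !(derivB, derivD, derivM, derivX, derivMn, mul1r).
rewrite !(hornerD, hornerN, hornerM, hornerX, hornerMn).
rewrite !(A0, A1, A2, B0, B1, B2).
set q := 2 * r.
(* c and d are the values at s of half of F n.+1 *+ 2 - 'X * F n and of its
   derivative. *)
pose c := 1 + 2 * q * b0 - 2 * q * s * a0.
pose d := q * b1 - 2 * q * a0 - q * s * a1.
split; split.
- by exists (a0 * c); rewrite /c; ring.
- by exists (a1 * c + 2 * a0 * d); rewrite /c /d; ring.
- exists (a2 * c + 2 * a1 * d
          + a0 * (2 * q + 4 * q * b2 - 4 * q * a1 - 2 * q * s * a2)).
  by rewrite /c /d; ring.
- by exists (b0 + q * b0 ^+ 2 + 4 * q * a0 ^+ 2); ring.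
- by exists ((1 + 2 * q * b0) * b1 + 8 * q * a0 * a1); ring.
- exists (b2 + b0 * (q + 2 * q * b2) + r * b1 ^+ 2 + 4 * q * a0 * a2
          + 2 * q * a1 ^+ 2).
  by rewrite /q; ring.
Qed.

Lemma fib_jet_pow2 (s t : R) l :
  s = 1 + 2 * t -> (0 < l)%N -> fib_jet_near_one s (2 ^+ l) (3 * 2 ^ l).
Proof.
move=> s_odd; case: l => // l _; elim: l => [|l IHl]; first exact: fib_jet_6 s_odd.
rewrite expnS mulnCA mul2n -addnn 2!exprS.
by apply: fib_jet_double; rewrite -exprS.
Qed.

(** In the second derivative of the addition formula, every term but
    F m'' * F n.+1 has a factor among F n, F n', F n'', F n.+1', F n.+1'', all
    of which vanish modulo q. *)
Lemma fib_deriv2_shift (s q : R) m n :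
  fib_jet_near_one s q n ->
  eqmod q (F (m + n))^`()^`().[s] (F m)^`()^`().[s].
Proof.
rewrite /fib_jet_near_one /eqmod fibpoly_add.
move: (F n) (F n.+1) (F m) (F m.+1) => A B C D.
case=> [[[a0 A0] [a1 A1] [a2 A2]] [[b0 B0] [b1 B1] [b2 B2]]].
rewrite !(derivB, derivD, derivM, derivX, mul1r).
rewrite !(hornerD, hornerN, hornerM, hornerX).
rewrite !(A0, A1, A2, B0, B1, B2).
exists (2 * C^`()^`().[s] * b0 + 2 * C^`().[s] * b1 + C.[s] * (1 + 2 * b2)
  + 4 * (D^`()^`().[s] - 2 * C^`().[s] - s * C^`()^`().[s]) * a0
  + 4 * (D^`().[s] - C.[s] - s * C^`().[s]) * a1
  + 2 * (D.[s] - s * C.[s]) * a2).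
by ring.
Qed.

End Jets.

(** * Two-adic integers *)

Lemma eqmod_cong2 k x y : eqmod (2 ^+ k) x y -> cong2 k x y.
Proof. by case=> t ->; exists t; rewrite addrC addKr. Qed.

Lemma residueZ_nat l m : residueZ l m%:R = 0 <-> (2 ^ l.+1 %| m)%N.
Proof.
rewrite rmorph_nat; split=> [/(congr1 val) /=|].
  by rewrite val_Zp_nat ?pow2_gt1 // => /eqP.
by case/dvdnP=> k ->; rewrite natrM pchar_Zp ?pow2_gt1 // mulr0.
Qed.

Lemma residueZ_low l (x : Z2) :
  (0 < l)%N -> (residueZ l x : nat)%:R = residueZ 1 x.
Proof.
case: l => // l _; apply: val_inj.
by rewrite /= val_Zp_nat ?pow2_gt1 // -[l.+1]addn1 residue_mod.
Qed.

Theorem lemma2p10 (s : Z2) (s_odd : exists t : Z2, s = 1 + 2 * t) :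
  (forall l : nat, (0 < l)%N ->
     cong2 l.+1 (fibpoly Z2 (3 * 2 ^ l)%N)^`(2).[s] 0 /\
     cong2 l.+1 (fibpoly Z2 (3 * 2 ^ l + 1)%N)^`(2).[s] (2 ^+ l)) /\
  (forall l : nat, (0 < l)%N ->
     periodic_of_period
       (fun m : nat => residueZ l (fibpoly Z2 m)^`(2).[s])
       (3 * 2 ^ l.+1)%N).
Proof.
case: s_odd => t s_odd.
have values l : (0 < l)%N ->
     cong2 l.+1 (fibpoly Z2 (3 * 2 ^ l)%N)^`(2).[s] 0 /\
     cong2 l.+1 (fibpoly Z2 (3 * 2 ^ l + 1)%N)^`(2).[s] (2 ^+ l).
  case/(fib_jet_pow2 s_odd)=> [[_ _ F2] [_ _ F2S]].
  by rewrite addn1; split; apply: eqmod_cong2; rewrite exprS.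
split=> // l l_gt0.
pose f k m := residueZ k (fibpoly Z2 m)^`(2).[s].
have per k : has_period (f k) (3 * 2 ^ k.+1)%N.
  split=> [|m]; first by rewrite muln_gt0 expn_gt0.
  apply/residueZ_eqP/eqmod_cong2/fib_deriv2_shift.
  exact: fib_jet_pow2 s_odd _.
rewrite -/(f l); apply: period_minimal (per l) _ => p p_pr.
rewrite Euclid_dvdM // Euclid_dvdX // !dvdn_prime2 // andbT.
case/orP=> /eqP ->; last first.
  (* p = 2: the value at 1 is 0, while the one at 1 + 3 * 2 ^ l is 2 ^ l. *)
  have -> : (3 * 2 ^ l.+1 %/ 2 = 3 * 2 ^ l)%N by rewrite expnS mulnCA mulKn.
  case=> _ /(_ 1%N); have [_ /residueZ_eqP] := values l l_gt0.
  rewrite /f addnC => ->; rewrite -[2 ^+ l]natrX.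
  rewrite !derivnS derivn0 /= !derivC hornerC rmorph0.
  by move/residueZ_nat; rewrite dvdn_Pexp2l // ltnn.
(* p = 3: reduce the period 2 ^ l.+1 modulo 4 and compare the values at 0
   and 4. *)
rewrite mulKn // => -[_ per_l].
have per1 : has_period (f 1%N) (2 ^ l.+1)%N.
  split=> [|m]; first by rewrite expn_gt0.
  by rewrite /f -!(residueZ_low _ l_gt0) [X in (nat_of_ord X)%:R]per_l.
have := has_period_gcd per1 (per 1%N).
have -> : gcdn (2 ^ l.+1) (3 * 2 ^ 2) = 4%N.
  case: (l) l_gt0 => // k _; rewrite 2!expnS mulnA [(3 * _)%N]mulnC -muln_gcdr.
  by have /eqP -> : coprime (2 ^ k) 3 by rewrite coprimeXl.
case=> _ /(_ 0%N); rewrite /f add0n !derivnS !derivn0 fib_jet_4.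
rewrite [fibpoly Z2 0]/= !deriv0 horner0 rmorph0.
have /residueZ_eqP -> : cong2 2 (6 * s) 2%:R.
  by apply: eqmod_cong2; exists (1 + 3 * t); rewrite s_odd; ring.
by move/residueZ_nat.
Qed.
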